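(* Let $N\ge 2$ and let $D_{2N}=\langle r,s : r^N=s^2=1,\ srs=r^{-1}\rangle$ be the dihedral group of order $2N$. Then $D_{2N}$ is $R_4$ if and only if $N\equiv 2 \pmod 4$.
   Context: For a finite group $G$, $\overline{G}=G\cup\{\infty\}$, and $K_V$ denotes the complete graph on vertex set $V$. $G$ acts on $\overline{G}$ by right multiplication, with $\infty g=\infty$ for all $g\in G$; for a subgraph $F$ of $K_{\overline{G}}$ and $g\in G$, $Fg$ is the graph obtained by replacing every vertex $v$ by $vg$. A $k$-factor of $K_V$ is a spanning $k$-regular subgraph, and a $k$-factorization is a set of $k$-factors whose edge sets partition the edge set of $K_V$. A $k$-factorization $\mathcal{F}$ of $K_{\overline{G}}$ is $1$-rotational if $Fg\in\mathcal{F}$ for all $F\in\mathcal{F}$ and $g\in G$. A finite group $G$ is called $R_k$ if there exists a $1$-rotational $k$-factorization of $K_{\overline{G}}$. *)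

(* Defs.v *)
From HB Require Import structures.
From mathcomp Require Import all_boot all_order all_fingroup.
Set Implicit Arguments. Unset Strict Implicit. Unset Printing Implicit Defensive.
Local Open Scope group_scope.

(* The whole finite group type gT plays the role of G; the vertex set
   \overline{G} = G \cup {oo} is [option gT], with [None] = oo. *)
Definition vtx (gT : finGroupType) := option gT.

Definition vact (gT : finGroupType) (v : option gT) (g : gT) : option gT :=
  omap (fun x => x * g) v.

Definition Kedges (V : finType) : {set {set V}} := [set e : {set V} | #|e| == 2].

(* A subgraph (spanning, given by its edge set F) is a k-factor of K_V if
   all its edges are edges of K_V and every vertex has degree k. *)
Definition kfactor (V : finType) (k : nat) (F : {set {set V}}) : bool :=
  (F \subset Kedges V) && [forall v : V, #|[set e in F | v \in e]| == k].

Definition kfactorization (V : finType) (k : nat) (FF : {set {set {set V}}}) : bool :=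
  [forall F in FF, kfactor k F] && partition FF (Kedges V).

Definition gtrans (gT : finGroupType) (F : {set {set option gT}}) (g : gT)
  : {set {set option gT}} :=
  [set (fun v => vact v g) @: e | e : {set option gT} in F].

Definition one_rotational (gT : finGroupType) (FF : {set {set {set option gT}}}) : bool :=
  [forall F in FF, forall g : gT, gtrans F g \in FF].

Definition R_k (k : nat) (gT : finGroupType) : Prop :=
  exists FF : {set {set {set option gT}}}, kfactorization k FF && one_rotational FF.

(* Main.v *)
Require Import Defs.
From mathcomp Require Import all_boot all_order all_fingroup all_solvable.
From mathcomp Require Import zify.
Set Implicit Arguments. Unset Strict Implicit. Unset Printing Implicit Defensive.
Local Open Scope group_scope.

(* Necessity: G is regular on the edges at oo, so the stabiliser K of a factor
   has order 4, and every involution, fixing some edge, is conjugate into K.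
   As 4 divides 2N, N is even. If N = 4k, the classes of z = r^{2k}, s and s r
   are distinct, so K = {1, z, s', z s'} with s' conjugate to s, and s r must be
   conjugate to z s; the parity of the exponent of r forbids this.

   Sufficiency: let N = 2m with m odd, z = r^m and Z = <z>. Modulo Z the
   patterned starter r^i <-> r^{-i} gives a base 2-factor of 4-cycles
   r^i, r^i s, r^{-i} s, r^{-i} together with the triangle oo, 1, s. Doubling
   every vertex other than oo along the cosets of Z (and joining x to x z in
   the coset of the triangle) gives the base 4-factor. *)

(** * From the dihedral presentation to generators and a normal form *)

Definition dihedral_gens (gT : finGroupType) (N : nat) (r s : gT) : Prop :=
  [/\ #[r] = N, s ^+ 2 = 1, r ^ s = r^-1, s \notin <[r]>
    & forall g, exists i (b : bool), g = r ^+ i * s ^+ b].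

(** 'D_(N.*2) satisfies the relations, so it is an image of the group, whose order is thus at least
    2N. The relations bound the orders of [r] and [s] by N and 2, so the product formula for [<[r]>]
    and [<[s]>] leaves only equalities and a trivial intersection. *)
Lemma dihedral_gensP (N : nat) (gT : finGroupType) :
  2 <= N ->
  [set: gT] \isog Grp (r : s : (r ^+ N = 1, s ^+ 2 = 1, s * r * s = r^-1)) ->
  exists r s : gT, dihedral_gens N r s /\ #|gT| = N.*2.
Proof.
move=> N2 isoG.
have sinv (hT : finGroupType) (s : hT) : s ^+ 2 = 1 -> s^-1 = s.
  by move=> s2; apply/eqP; rewrite eq_invg_mul -expg2 s2.
have [[r s] /= /eqP[defG rN s2 rs]] := existsP (isoGrp_hom isoG).
have leG : (N.*2 <= #|[set: gT]|)%N.
  have DN : (2 < N.*2)%N by lia.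
  have oD : #|[set: 'D_(N.*2)]| = N.*2.
    exact: card_dihedral.
  rewrite -oD; apply: leq_homg; rewrite isoG.
  have := isoGrp_hom (Grp_dihedral N2).
  case/existsP=> [[x y] /= /eqP[defD xN y2 xy]].
  apply/existsP; exists (x, y) => /=; rewrite defD xN y2 !xpair_eqE !eqxx /=.
  by rewrite -xy conjgE sinv // mulgA.
have rJ : r ^ s = r^-1 by rewrite -rs conjgE sinv // mulgA.
have norm : <[s]> \subset 'N(<[r]>).
  by rewrite cycle_subG; apply/normP; rewrite -cycleJ rJ cycleV.
have gE g : exists i (b : bool), g = r ^+ i * s ^+ b.
  have : g \in <[r]> <*> <[s]> by rewrite defG inE.
  rewrite norm_joinEr // => /mulsgP[_ _ /cycleP[i ->] /cycleP[j ->] ->].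
  exists i, (odd j); congr (_ * _).
  by rewrite -[in LHS](odd_double_half j) expgD -mul2n expgM s2 expg1n mulg1.
have rN_le : (#[r] <= N)%N by rewrite dvdn_leq ?order_dvdn ?rN //; lia.
have s2_le : (#[s] <= 2)%N by rewrite dvdn_leq ?order_dvdn ?s2.
have := mul_cardG <[r]> <[s]>.
rewrite /= -norm_joinEr // defG -!orderE => eqG.
have I0 := cardG_gt0 (<[r]> :&: <[s]>).
have bound a b c (i : nat) :
    (a <= N -> b <= 2 -> N.*2 <= c -> 0 < i -> a * b = c * i ->
    [/\ a = N, b = 2, c = N.*2 & i = 1])%N.
  move=> aN b2 cN i0 E.
  have ab : (a * b <= N * 2)%N by apply: leq_mul.
  have ci : (c <= c * i)%N by rewrite leq_pmulr.
  have cE : c = N.*2 by lia.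
  have bE : b = 2 by nia.
  have aE : a = N by nia.
  by split=> //; nia.
have [or os oG oI] := bound _ _ _ _ rN_le s2_le leG I0 eqG.
exists r, s; split; last by rewrite -cardsT.
split=> //.
apply/negP=> rs'.
have : s \in <[r]> :&: <[s]> by rewrite inE rs' cycle_id.
move/eqP: oI; rewrite -trivg_card1 => /eqP ->; rewrite inE => /eqP s1.
by move: os; rewrite s1 order1.
Qed.

(** * Edge sets of graphs given by an adjacency relation *)

Lemma set2_inj (T : finType) (a b c d : T) :
  [set a; b] = [set c; d] -> (a = c /\ b = d) \/ (a = d /\ b = c).
Proof.
move=> E.
have /set2P ca : c \in [set a; b] by rewrite E set21.
have /set2P da : d \in [set a; b] by rewrite E set22.
have /set2P ac : a \in [set c; d] by rewrite -E set21.
have /set2P bc : b \in [set c; d] by rewrite -E set22.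
by intuition congruence.
Qed.

Lemma set2_injr (T : finType) (a : T) : injective (fun b => [set a; b]).
Proof. by move=> b c /set2_inj[[]//|[-> ->]]. Qed.

Definition graph_edges (V : finType) (adj : rel V) : {set {set V}} :=
  [set [set p.1; p.2] | p in [set p : V * V | adj p.1 p.2]].

Section Graph.
Variables (V : finType) (adj : rel V).
Hypotheses (adjC : symmetric adj) (adjI : irreflexive adj).

Lemma mem_graph_edges u v : ([set u; v] \in graph_edges adj) = adj u v.
Proof.
apply/imsetP/idP => [[[a b]] | uv]; last by exists (u, v); rewrite ?inE.
by rewrite inE /= => ab /set2_inj[[-> ->]|[-> ->]]; rewrite // adjC.
Qed.

Lemma graph_edges_sub : graph_edges adj \subset Kedges V.
Proof.
apply/subsetP=> _ /imsetP[[a b] /[!inE] /= ab ->]; rewrite cards2.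
by case: (a =P b) ab => // ->; rewrite adjI.
Qed.

End Graph.

Lemma card_incident (V : finType) (F : {set {set V}}) (v : V) :
  F \subset Kedges V ->
  #|[set e in F | v \in e]| = #|[set w | [set v; w] \in F]|.
Proof.
move=> /subsetP FK.
rewrite -(card_imset _ (@set2_injr _ v)); apply: eq_card => e.
rewrite inE; apply/andP/imsetP => [[eF ve] | [w /[!inE] wF ->]].
  have /[!inE]/cards2P[a [b [_ E]]] := FK _ eF.
  move: ve eF; rewrite {e}E !inE => /orP[/eqP <-|/eqP <-] eF.
    by exists b; rewrite ?inE.
  by exists a; rewrite ?inE // setUC.
by rewrite wF !inE eqxx.
Qed.

(** * Translation of vertices and factors, and the stabiliser of a factor *)

Section Act.
Variable gT : finGroupType.
Implicit Types (g h : gT) (u v : option gT) (F : {set {set option gT}}).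

Lemma vact1 v : vact v 1 = v.
Proof. by case: v => //= x; rewrite mulg1. Qed.

Lemma vactM v g h : vact v (g * h) = vact (vact v g) h.
Proof. by case: v => //= x; rewrite mulgA. Qed.

Lemma vact_set2 u v g : (fun w => vact w g) @: [set u; v] = [set vact u g; vact v g].
Proof. by rewrite imsetU !imset_set1. Qed.

Lemma gtransM F g h : gtrans F (g * h) = gtrans (gtrans F g) h.
Proof.
rewrite /gtrans -imset_comp; apply: eq_imset => e /=.
by rewrite -imset_comp; apply: eq_imset => v /=; rewrite vactM.
Qed.

Lemma gtrans1 F : gtrans F 1 = F.
Proof.
rewrite -[RHS]imset_id; apply: eq_imset => e.
by rewrite -[RHS]imset_id; apply: eq_imset => v; rewrite vact1.
Qed.

Lemma mem_gtransJ g F u v :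
  [set u; v] \in F -> [set vact u g; vact v g] \in gtrans F g.
Proof. by move=> uvF; rewrite -vact_set2 imset_f. Qed.

Lemma mem_gtrans F u v g :
  ([set u; v] \in gtrans F g) = ([set vact u g^-1; vact v g^-1] \in F).
Proof.
apply/idP/idP=> /mem_gtransJ; last first.
  by move/(_ g); rewrite -!vactM mulVg !vact1.
by move/(_ g^-1); rewrite -gtransM mulgV gtrans1.
Qed.

Lemma gtrans_Kedges F g :
  F \subset Kedges (option gT) -> gtrans F g \subset Kedges (option gT).
Proof.
move/subsetP=> FK; apply/subsetP=> _ /imsetP[e /FK /[!inE] e2 ->].
rewrite card_imset //; apply: (can_inj (g := fun w => vact w g^-1)) => v.
by rewrite -vactM mulgV vact1.
Qed.

Lemma kfactor_gtrans k F g :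
  kfactor k F -> kfactor k (gtrans F g).
Proof.
case/andP=> FK /forallP degF; rewrite /kfactor gtrans_Kedges //=.
apply/forallP=> v; rewrite card_incident ?gtrans_Kedges //.
have := degF (vact v g^-1); rewrite card_incident //.
congr (_ == k).
have vinj : injective (fun w => vact w g^-1).
  by apply: (can_inj (g := fun w => vact w g)) => u; rewrite -vactM mulVg vact1.
rewrite -(card_imset [set w | [set v; w] \in gtrans F g] vinj).
apply: eq_card => w; rewrite inE.
apply/idP/imsetP => [wF | [u /[!inE]]].
  exists (vact w g); last by rewrite -vactM mulgV vact1.
  by rewrite inE mem_gtrans -!vactM mulgV vact1.
by rewrite mem_gtrans => uF ->.
Qed.

End Act.

(* If the factor [F0] contains the edge {oo, 1}, then g stabilises [F0] iff
   {oo, g} is in [F0]; and since an involution d fixes the edge {1, d}, it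
   fixes the factor [F0 a] containing that edge. *)
Lemma R_k_stabiliser (k : nat) (gT : finGroupType) :
  0 < k -> R_k k gT ->
  exists K : {group gT}, #|K| = k /\
    forall d : gT, d ^+ 2 = 1 -> d != 1 -> exists a, d ^ a \in K.
Proof.
move=> k0 [FF /andP[/andP[/forall_inP kF /and3P[/eqP covF tiF _]] /forall_inP rotF]].
have rot F g : F \in FF -> gtrans F g \in FF by move=> /rotF /forallP.
have sub F : F \in FF -> F \subset Kedges (option gT) by move=> /kF /andP[].
have uniqF F1 F2 e : F1 \in FF -> F2 \in FF -> e \in F1 -> e \in F2 -> F1 = F2.
  move=> F1F F2F e1 e2.
  by rewrite -(def_pblock tiF F1F e1) -(def_pblock tiF F2F e2).
have cov e : e \in Kedges (option gT) -> exists2 F, F \in FF & e \in F.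
  by rewrite -covF => /bigcupP.
have [F0 F0F e0] : exists2 F, F \in FF & [set None; Some (1 : gT)] \in F.
  by apply: cov; rewrite inE cards2.
pose K := [set g | gtrans F0 g == F0].
have F0g g : [set None; Some g] \in gtrans F0 g.
  by have := mem_gtransJ g e0; rewrite /= mul1g.
have groupK : group_set K.
  apply/group_setP; split=> [|g h]; first by rewrite inE gtrans1.
  by rewrite !inE => /eqP gK /eqP hK; rewrite gtransM gK hK.
exists (group groupK); split=> [|d d2 d1] /=.
  have /forallP/(_ None) := proj2 (andP (kF _ F0F)).
  rewrite card_incident ?sub // => /eqP <-.
  have Sinj : injective (@Some gT) by move=> x y [].
  rewrite -(card_imset K Sinj); apply: eq_card => w; rewrite inE.
  apply/imsetP/idP => [[g /[!inE]/eqP gK ->] | wF]; first by rewrite -gK.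
  case: w wF => [g gF|].
    by exists g; rewrite // inE (uniqF _ _ _ (rot _ g F0F) F0F (F0g g) gF).
  by move=> /(subsetP (sub _ F0F)); rewrite inE setUid cards1.
have [F FF_F eF] : exists2 F, F \in FF & [set Some 1; Some d] \in F.
  apply: cov; rewrite inE cards2.
  by have -> : Some 1 != Some d by apply: contraNneq d1 => -[<-].
(* The positive degree of [F] at oo gives an edge {oo, a}; it also lies in the translate of [F0] by
   [a], so the two factors coincide. *)
have [a aF] : exists a, [set None; Some a] \in F.
  have /forallP/(_ None) := proj2 (andP (kF _ FF_F)).
  rewrite card_incident ?sub // => /eqP ck.
  have /card_gt0P[[a|] /[!inE] wF] : 0 < #|[set w | [set None; w] \in F]|.
  - by rewrite ck.
  - by exists a.
  by have := subsetP (sub _ FF_F) _ wF; rewrite inE setUid cards1.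
have Fa : F = gtrans F0 a := uniqF _ _ _ FF_F (rot _ a F0F) aF (F0g a).
have Fd : gtrans F d = F.
  apply: (uniqF _ _ _ (rot _ d FF_F) FF_F _ eF).
  have := mem_gtransJ d eF.
  by rewrite /= mul1g -expg2 d2 setUC.
exists a^-1; rewrite inE conjgE invgK mulgA 2!gtransM -Fa Fd Fa -gtransM mulgV.
by rewrite gtrans1.
Qed.

(** * Computation rules in the dihedral group *)

Section Dihedral.
Variables (gT : finGroupType) (N : nat) (r s : gT).
Hypothesis gens : dihedral_gens N r s.

Lemma dihedral_invg : s^-1 = s.
Proof. by case: gens => _ s2 _ _ _; apply/eqP; rewrite eq_invg_mul -expg2 s2. Qed.

Lemma dihedral_ss : s * s = 1.
Proof. by rewrite -{1}dihedral_invg mulVg. Qed.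

Lemma dihedral_mulsr i : s * r ^+ i = r ^- i * s.
Proof.
case: gens => _ s2 rs _ _.
have : (r ^+ i) ^ s = r ^- i by rewrite conjXg rs expVgn.
by move=> <-; rewrite conjgE dihedral_invg -!mulgA dihedral_ss mulg1.
Qed.

Lemma dihedral_mulsrV i : s * r ^- i = r ^+ i * s.
Proof.
apply: (mulgI s); rewrite !mulgA dihedral_mulsr -[_ * s * s]mulgA.
by rewrite dihedral_ss mulg1 mul1g.
Qed.

(** [r ^+ n] is its own inverse, so the inversion induced by [s] fixes it. *)
Lemma dihedral_center_half n : N = n.*2 -> (r ^+ n) \in 'Z([set: gT]).
Proof.
move=> Nn; case: gens => or _ _ _ gE.
have rV : r ^- n = r ^+ n.
  by apply/eqP; rewrite eq_invg_mul -expgD addnn -Nn -or expg_order.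
apply/centerP; split=> [|g _]; first by rewrite inE.
have [i [b ->]] := gE g; rewrite /commute mulgA -expgD addnC expgD -!mulgA.
congr (_ * _); case: b; rewrite ?mulg1 ?mul1g //.
by rewrite expg1 dihedral_mulsr rV.
Qed.
End Dihedral.

(** * Necessity of the congruence *)

Lemma R_4_dihedral_mod4 (gT : finGroupType) (N : nat) (r s : gT) :
  2 <= N -> dihedral_gens N r s -> #|gT| = N.*2 ->
  R_k 4 gT -> N = 2 %[mod 4].
Proof.
move=> N2 gens oG /R_k_stabiliser[] // K [oK invK].
have := cardSg (subsetT K); rewrite oK cardsT oG => dN.
(* Lagrange has made N even, so it remains to refute 4 | N. *)
case N4: (4 %| N); last by lia.
have [k Nk] : exists k, N = k.*2.*2.
  by exists (N %/ 4); lia.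
have [or s2 rs sr gE] := gens.
set z := r ^+ k.*2.
have zZ : z \in 'Z([set: gT]) by apply: dihedral_center_half gens _ Nk.
have zC g : z * g = g * z by have /centerP[_ /(_ g)] := zZ; apply; rewrite inE.
have zJ g : z ^ g = z by rewrite conjgE zC mulgA mulVg mul1g.
have z1 : z != 1 by rewrite -order_dvdn or; apply/negP=> /dvdn_leq; lia.
have z2 : z ^+ 2 = 1 by rewrite -expgM muln2 -Nk -or expg_order.
have s1 : s != 1 by apply: contraNneq sr => ->.
have ssr : s * r != 1.
  by apply: contraNneq sr => /eqP; rewrite -eq_invg_mul => /eqP E;
    rewrite -groupV E cycle_id.
have sr2 : (s * r) ^+ 2 = 1.
  rewrite expg2 mulgA -[s * r * s]mulgA.
  have -> : r * s = s * r^-1 by rewrite (dihedral_mulsrV gens 1).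
  by rewrite mulgA (dihedral_ss gens) mul1g mulVg.
have [a /[!zJ] zK] := invK _ z2 z1.
have [b sK] := invK _ s2 s1.
have [c tK] := invK _ sr2 ssr.
(* parity of the exponent of [r] separates the classes of [s] and [s * r] *)
have nconj i g : s * r ^+ i.*2 != (s * r) ^ g.
  have [j [b' ->]] := gE g; apply/eqP; rewrite conjgM.
  have -> : (s * r) ^ (r ^+ j) = s * r ^+ j.*2.+1.
    rewrite conjgE !mulgA -(dihedral_mulsr gens) -!mulgA -expgS -expgD.
    by congr (_ * _ ^+ _); lia.
  (* Conjugation by [s] negates the odd exponent [j.*2.+1]. As N is even, an odd exponent never
     agrees with the even [i.*2] modulo N. *)
  case: b'; rewrite ?conjg1.
    rewrite expg1 conjgE (dihedral_invg gens) !mulgA (dihedral_ss gens) mul1g.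
    rewrite -(dihedral_mulsrV gens) => /mulgI E2.
    have : r ^+ (i.*2 + j.*2.+1) == 1 by rewrite expgD E2 mulVg.
    by rewrite -order_dvdn or Nk => /dvdnP[q]; lia.
  move/mulgI/eqP; rewrite eq_expg_mod_order or => /eqP E.
  by have := congr1 odd E; rewrite !odd_mod ?Nk ?odd_double //= odd_double.
have zs : z * s ^ b \in K by rewrite groupM.
have KE : K :=: [set 1; z; s ^ b; z * s ^ b].
  have sbz : s ^ b != z.
    rewrite -(zJ b) (inj_eq (conjg_inj b)).
    by apply: contraNneq sr => ->; rewrite mem_cycle.
  apply/esym/eqP; rewrite eqEcard oK !subUset !sub1set group1 zK sK zs /=.
  have sb1 : s ^ b != 1 by rewrite conjg_eq1.
  rewrite setUC cardsU1 setUC cardsU1 cards2 !inE (eq_sym 1) z1.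
  rewrite (negPf sb1) (negPf sbz).
  have -> : (z * s ^ b == 1) = false.
    rewrite -eq_invg_mul.
    have -> : z^-1 = z by apply/eqP; rewrite eq_invg_mul -expg2 z2.
    by rewrite eq_sym (negPf sbz).
  have -> : (z * s ^ b == z) = false.
    by rewrite -[X in _ == X]mulg1 (inj_eq (mulgI z)) (negPf sb1).
  by rewrite -[X in _ == X]mul1g (inj_eq (mulIg _)) (negPf z1).
move: tK; rewrite KE !inE -!orbA => /or4P[] /eqP E.
- by case/eqP: ssr; apply: (conjg_inj c); rewrite E conj1g.
- have sz : s * r = z by rewrite -[RHS](zJ c) in E; apply: conjg_inj E.
  by case/negP: sr; rewrite -(groupMr _ (cycle_id r)) sz mem_cycle.
- by case/eqP: (nconj 0 (c * b^-1)); rewrite conjgM E conjgK mulg1.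
(* As [z] is central, [z * s ^ b] is a conjugate of [s * z], where [r] has the even exponent
   [k.*2]. *)
case/eqP: (nconj k (c * b^-1)); rewrite conjgM E -{1}(zJ b) -conjMg conjgK.
by rewrite zC.
Qed.

(** * The base factor and its translates *)

(* In the application [Z] is generated by the central involution r^m and [par]
   is the parity of the number of letters s, so that [par] separates edges
   {x, y} with y in x s Z ([nbA]) from those with y in s x s Z ([nbB]). *)
Section BaseFactor.
Variables (gT : finGroupType) (Z : {group gT}) (s : gT) (par : gT -> bool).
Hypothesis Zcentral : Z \subset 'Z([set: gT]).
Hypothesis Z2 : #|Z| = 2.
Hypothesis ss : s * s = 1.
Hypothesis parM : forall a b, par (a * b) = par a (+) par b.
Hypothesis pars : par s.
Hypothesis parZ : forall p, p \in Z -> ~~ par p.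
Hypothesis Cs4 : #|'C[s]| = 4.
(** The product is the commutator of [s] and [g], so commuting with [s] modulo [Z] already means
    commuting with [s]. *)
Hypothesis comm_s : forall g, s * g^-1 * s * g \in Z -> g \in 'C[s].
(** The starter condition: every difference [d] other than 1 is realised by an edge {w, d w} of the
    base factor. *)
Hypothesis cover_s : forall d, exists w,
  (s * w^-1 * d * w \in Z) || (s * w^-1 * s * d * w \in Z).

Let ZC p g : p \in Z -> p * g = g * p.
Proof. by move=> /(subsetP Zcentral) /centerP[_]; apply; rewrite inE. Qed.

Let Zswap a b : a * b \in Z -> b * a \in Z.
Proof.
move=> abZ; suff <- : a * b = b * a by [].
by apply: (mulgI a); rewrite -(ZC a abZ) mulgA.
Qed.

Let sV : s^-1 = s.
Proof. by apply/eqP; rewrite eq_invg_mul ss. Qed.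

Let par1 : par 1 = false.
Proof. by apply/negbTE/parZ. Qed.

Let parV a : par a^-1 = par a.
Proof.
by have := parM a^-1 a; rewrite mulVg par1; case: (par _); case: (par _).
Qed.

Let nbA x y := s * x^-1 * y \in Z.
Let nbB x y := s * x^-1 * s * y \in Z.

Let nbAC x y : nbA x y -> nbA y x.
Proof.
rewrite /nbA -groupV !invMg invgK sV mulgA => /Zswap.
by rewrite !mulgA.
Qed.

Let nbBC x y : nbB x y -> nbB y x.
Proof.
rewrite /nbB -groupV !invMg invgK sV !mulgA => /Zswap.
by rewrite !mulgA.
Qed.

Let parA x y : nbA x y -> par y = ~~ par x.
Proof. by move/parZ; rewrite !parM parV pars; case: (par _); case: (par _). Qed.

Let parB x y : nbB x y -> par y = par x.
Proof. by move/parZ; rewrite !parM parV pars; case: (par _); case: (par _). Qed.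

Definition base_adj (u v : option gT) : bool :=
  match u, v with
  | None, None => false
  | None, Some x | Some x, None => x \in 'C[s]
  | Some x, Some y => (x != y) && (nbA x y || nbB x y)
  end.

Lemma base_adjC : symmetric base_adj.
Proof.
move=> [x|] [y|] //=; rewrite eq_sym; congr (_ && _).
by apply/orP/orP; case=> [/nbAC|/nbBC] ->; rewrite ?orbT; [left|right|left|right].
Qed.

Lemma base_adjI : irreflexive base_adj.
Proof. by move=> [x|] //=; rewrite eqxx. Qed.

Let nbB_refl x : nbB x x = (x \in 'C[s]).
Proof.
apply/idP/idP => [|/cent1P xs]; first exact: comm_s.
by rewrite /nbB -mulgA -xs mulgA mulgKV ss group1.
Qed.

(** The cosets x s Z and s x s Z are separated by [par] and offer four neighbours of x. If x
    commutes with [s], the second coset contains x itself, and oo takes its place. *)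
Lemma card_base_adj u : #|[set v | base_adj u v]| = 4.
Proof.
have Sinj : injective (@Some gT) by move=> x y [].
case: u => [x|]; last first.
  rewrite -Cs4 -(card_imset 'C[s] Sinj); apply: eq_card => -[y|] /=.
    by rewrite inE mem_imset.
  by rewrite inE; apply/esym/imsetP => -[].
pose S := [set y | nbA x y || nbB x y].
have cardS : #|S| = 4.
  have -> : S = ((s * x^-1)^-1 *: Z) :|: ((s * x^-1 * s)^-1 *: Z).
    by apply/setP=> y; rewrite !inE !mem_lcoset !invgK.
  rewrite cardsU !card_lcoset Z2.
  suff -> : (s * x^-1)^-1 *: Z :&: (s * x^-1 * s)^-1 *: Z = set0.
    by rewrite cards0.
  apply/setP=> y; rewrite !inE !mem_lcoset !invgK; apply/negP=> /andP[/parA E].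
  by move/parB; rewrite E; case: (par x).
have xS : (x \in S) = (x \in 'C[s]).
  rewrite inE -nbB_refl; case nA: (nbA x x) => //.
  by have := parA nA; case: (par x).
rewrite -cardS (cardsD1 x S) xS.
case xC: (x \in 'C[s]).
  rewrite (cardsD1 None) inE /= xC -(card_imset (S :\ x) Sinj); congr (_ + _).
  apply: eq_card => -[y|]; last by rewrite !inE; apply/esym/imsetP => -[].
  by rewrite mem_imset // !inE /= eq_sym.
rewrite -(card_imset (S :\ x) Sinj); apply: eq_card => -[y|].
  by rewrite mem_imset // !inE /= eq_sym.
by rewrite !inE /= xC; apply/esym/imsetP => -[].
Qed.

(** If x and y are joined through a central p in [Z], translation by h multiplies p by the
    commutator of [s] and h. Adjacency of the same type therefore survives exactly when that
    commutator lies in [Z]. *)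
Let nbAM x y h : nbA (x * h) (y * h) = (s * h^-1 * s * (s * x^-1 * y) * h \in Z).
Proof. by rewrite /nbA invMg !mulgA -[_ * s * s]mulgA ss mulg1. Qed.

Let nbBM x y h : nbB (x * h) (y * h) = (s * h^-1 * s * (s * x^-1 * s * y) * h \in Z).
Proof. by rewrite /nbB invMg !mulgA -[_ * s * s]mulgA ss mulg1. Qed.

Let ZJ h p : h \in 'C[s] -> p \in Z -> s * h^-1 * s * p * h \in Z.
Proof.
move=> /groupVr/cent1P sh pZ.
by rewrite -sh -[_ * s * s]mulgA ss mulg1 -mulgA (ZC h pZ) mulKg.
Qed.

Lemma base_adj_stable h u v :
  h \in 'C[s] -> base_adj (vact u h) (vact v h) = base_adj u v.
Proof.
have imp k w t : k \in 'C[s] -> base_adj w t -> base_adj (vact w k) (vact t k).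
  move=> kC; case: w t => [x|] [y|] //=; rewrite ?groupMr // (inj_eq (mulIg k)).
  case/andP=> -> /orP[nb|nb]; first by rewrite nbAM ZJ.
  by rewrite nbBM ZJ ?orbT.
move=> hC; apply/idP/idP=> [|/imp]; last exact.
by move/(imp h^-1); rewrite -!vactM mulgV !vact1; apply; rewrite groupV.
Qed.

(** This makes distinct translates disjoint. Right translation preserves whether the ends of an edge
    have equal [par], so the edge keeps its type; the commutator of [s] and h is then in [Z] and
    [comm_s] applies. At oo, membership in the subgroup ['C[s]] suffices. *)
Lemma base_adj_inj h u v :
  base_adj u v -> base_adj (vact u h) (vact v h) -> h \in 'C[s].
Proof.
have red p : p \in Z -> s * h^-1 * s * p * h \in Z -> h \in 'C[s].
  by move=> pZ; rewrite -mulgA (ZC _ pZ) mulgA groupMr // => /comm_s.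
case: u v => [x|] [y|] //=; last 2 first.
- by move=> xC; rewrite groupMl.
- by move=> xC; rewrite groupMl.
have parn : par (x * h) = par (y * h) -> par x = par y.
  by rewrite !parM => /addIb.
case/andP=> _ /orP[] nb /andP[_ /orP[] nb'].
- by move: nb'; rewrite nbAM; apply: red.
- by have := parn (esym (parB nb')); rewrite (parA nb); case: (par x).
- by have := parA nb'; rewrite !parM (parB nb); case: (par x); case: (par h).
- by move: nb'; rewrite nbBM; apply: red.
Qed.

Lemma base_adj_cover u v : u != v -> exists h, base_adj (vact u h) (vact v h).
Proof.
case: u v => [x|] [y|] //=.
- rewrite (inj_eq (@Some_inj _)) => xy.
  (* The translation by x^-1 w sends x to w and y to d w, where d = y x^-1. *)
  have [w wd] := cover_s (y * x^-1); exists (x^-1 * w).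
  by rewrite (inj_eq (mulIg _)) xy /nbA /nbB mulKVg -!mulgA in wd *.
- by move=> _; exists x^-1; rewrite mulgV group1.
- by move=> _; exists y^-1; rewrite mulgV group1.
Qed.

(** The factorization is the orbit of the base factor. Two translates, by g and h, that share an
    edge have g h^-1 in ['C[s]], which stabilises the base factor, so they are equal. *)
Lemma base_R_4 : R_k 4 gT.
Proof.
pose F := graph_edges base_adj.
have FK : F \subset Kedges _ := graph_edges_sub base_adjI.
have FE u v : ([set u; v] \in F) = base_adj u v := mem_graph_edges base_adjC u v.
have kF : kfactor 4 F.
  rewrite /kfactor FK /=; apply/forallP=> v; rewrite card_incident //.
  by rewrite -(card_base_adj v); apply/eqP/eq_card=> w; rewrite !inE FE.
have stabF h : h \in 'C[s] -> gtrans F h = F.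
  move=> hC; have ext e : e \in Kedges _ -> (e \in gtrans F h) = (e \in F).
    rewrite inE => /cards2P[u [v [_ ->]]].
    by rewrite mem_gtrans !FE base_adj_stable ?groupV.
  apply/setP=> e; case eK: (e \in Kedges (option gT)); first exact: ext.
  have out (A : {set {set option gT}}) : A \subset Kedges _ -> (e \in A) = false.
    by move=> /subsetP AK; apply: contraFF eK; apply: AK.
  by rewrite !out ?gtrans_Kedges.
exists [set gtrans F g | g in [set: gT]].
apply/andP; split; last first.
  apply/forall_inP=> _ /imsetP[g _ ->]; apply/forallP=> h.
  by rewrite -gtransM imset_f.
apply/andP; split.
  by apply/forall_inP=> _ /imsetP[g _ ->]; apply: kfactor_gtrans.
apply/and3P; split.
- rewrite eqEsubset; apply/andP; split.
    by apply/bigcupsP=> _ /imsetP[g _ ->]; apply: gtrans_Kedges.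
  apply/subsetP=> e; rewrite inE => /cards2P[u [v [uv ->]]].
  have [h hF] := base_adj_cover uv.
  apply/bigcupP; exists (gtrans F h^-1); first by rewrite imset_f.
  by rewrite mem_gtrans invgK FE.
- apply/trivIsetP=> _ _ /imsetP[g _ ->] /imsetP[h _ ->].
  apply: contraR => /pred0Pn[e /andP[/= eg eh]].
  have := subsetP (gtrans_Kedges g FK) _ eg.
  rewrite inE => /cards2P[u [v [_ E]]]; move: eg eh; rewrite {}E !mem_gtrans !FE.
  move=> eg eh; have ghC : g * h^-1 \in 'C[s].
    by apply: (base_adj_inj eg); rewrite -!vactM !mulgA mulVg !mul1g.
  by rewrite -{2}(stabF _ ghC) -gtransM mulgKV.
- apply/imsetP=> -[g _ E]; have := FE None (Some 1).
  rewrite /= group1 => /(mem_gtransJ g).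
  by rewrite -E inE.
Qed.
End BaseFactor.

(** * Sufficiency: the base factor in the dihedral group *)

Lemma dihedral_R_4 (gT : finGroupType) (m : nat) (r s : gT) :
  odd m -> dihedral_gens m.*2 r s -> R_k 4 gT.
Proof.
move=> om gens; have [or s2 rs sr gE] := gens.
pose z := r ^+ m.
have zZ : z \in 'Z([set: gT]) by apply: (dihedral_center_half gens).
have oz : #[z] = 2.
  have m0 : (0 < m)%N by case: m om {gens or z zZ}.
  by rewrite orderXdiv or -muln2 ?dvdn_mulr // mulKn.
have Zr : <[z]> \subset <[r]> by rewrite cycle_subG mem_cycle.
(* Modulo [<[z]>] the rotations form a group of odd order m, where an element with trivial square is
   trivial. *)
have half i : r ^+ i.*2 \in <[z]> -> r ^+ i \in <[z]>.
  move=> iZ; have : r ^+ i.*2 ^+ 2 == 1 by rewrite -order_dvdn -oz order_dvdG.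
  rewrite -expgM -order_dvdn or => /dvdnP[q Eq].
  have /dvdnP[t ->] : (m %| i)%N.
    have : (m %| 2 * i)%N by apply/dvdnP; exists q; lia.
    by rewrite Gauss_dvdr // coprimen2.
  by rewrite mulnC expgM mem_cycle.
have ZC p : p \in <[z]> -> p \in 'C[s].
  rewrite -cycle_subG => pZ; apply/cent1P.
  have : p \in 'Z([set: gT]).
    by rewrite -cycle_subG (subset_trans pZ) // cycle_subG.
  by move/centerP=> [_]; apply; rewrite inE.
have parE i (b : bool) : (r ^+ i * s ^+ b \notin <[r]>) = b.
  by rewrite groupMl ?mem_cycle //; case: b; rewrite ?group1.
have C1 : s \in 'C[s] by apply/cent1P.
apply: (@base_R_4 gT <[z]> s (fun g => g \notin <[r]>)) => //.
- by rewrite /= cycle_subG.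
- move=> a b; have [i [c ->]] := gE a; have [j [d ->]] := gE b.
  rewrite !parE; case: c; last by rewrite mulg1 mulgA -expgD parE.
  rewrite -mulgA [s * _]mulgA (dihedral_mulsr gens) -mulgA.
  rewrite groupMl ?mem_cycle // groupMl ?groupV ?mem_cycle //.
  by case: d; rewrite ?mulg1 ?(dihedral_ss gens) ?group1.
- by move=> p pZ; rewrite negbK (subsetP Zr).
- have -> : 'C[s] = <[z]> :|: s *: <[z]>.
    apply/setP=> g; rewrite in_setU; apply/idP/orP; last first.
      case=> [|/lcosetP[p pZ ->]]; first exact: ZC.
      by rewrite groupMl // ZC.
    have [i [b ->]] := gE g => gC.
    have iC : r ^+ i \in 'C[s] by rewrite -(groupMr _ (groupX b C1)).
    have iZ : r ^+ i \in <[z]>.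
      apply: half; rewrite -addnn expgD.
      move/cent1P: iC; rewrite /commute (dihedral_mulsr gens) => /mulIg {1}->.
      by rewrite mulVg group1.
    case: b {gC}; last by left; rewrite mulg1.
    by right; apply/lcosetP; exists (r ^+ i); rewrite // expg1; apply/cent1P.
  rewrite cardsU card_lcoset -orderE oz.
  suff -> : <[z]> :&: s *: <[z]> = set0 by rewrite cards0.
  apply/setP=> g; rewrite !inE; apply/negP=> /andP[gZ].
  rewrite mem_lcoset (groupMr _ gZ) groupV => /(subsetP Zr).
  exact/negP.
(* The commutator of [s] with [r ^+ i * s ^+ b] is r^(2i) or r^(-2i), so [half] puts [r ^+ i] in
   [<[z]>]. *)
- move=> g; have [i [b ->]] := gE g; rewrite invMg => H.
  rewrite (groupMr _ (groupX b C1)); apply: ZC; apply: half; move: H; case: b.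
    rewrite expg1 !mulgA mulgV mul1g -[_ * s * r ^+ i]mulgA (dihedral_mulsr gens).
    rewrite -!mulgA (dihedral_ss gens) mulg1 -invMg groupV -expgD.
    by rewrite addnn.
  rewrite !mulg1 invg1 mul1g (dihedral_mulsrV gens) -[_ * s * s]mulgA.
  by rewrite (dihedral_ss gens) mulg1 -expgD addnn.
- move=> d; have [i [b ->]] := gE d.
  have zi : r ^+ (m * i) \in <[z]> by rewrite expgM mem_cycle.
  case: b; last first.
    (* For the rotation d = r^i the condition becomes w d w in [<[z]>]; the exponent (m-1)i/2 for w
       makes this product r^(mi). *)
    exists (r ^+ (m./2 * i)); apply/orP; right.
    rewrite (dihedral_mulsrV gens) -[_ * s * s]mulgA (dihedral_ss gens) !mulg1.
    by rewrite -!expgD (_ : (_ + _ + _ = m * i)%N) //; nia.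
  (* For the reflection d = r^i s the condition becomes w r^(-i) w in [<[z]>]; the exponent (m+1)i/2
     again gives r^(mi). *)
  have E : r ^+ (m./2.+1 * i) = r ^+ i * r ^+ (m./2 * i) by rewrite mulSn expgD.
  exists (r ^+ (m./2.+1 * i)); apply/orP; left.
  rewrite (dihedral_mulsrV gens) mulgA -[_ * s * r ^+ i]mulgA (dihedral_mulsr gens).
  rewrite -!mulgA (mulgA s s) (dihedral_ss gens) mul1g.
  rewrite [X in _ * (_ * X)]E mulKg -expgD.
  by rewrite -mulnDl (_ : (_ + _ = m)%N) //; lia.
Qed.

(* gT is (isomorphic to) D_{2N} = < r, s | r^N = s^2 = 1, s r s = r^-1 >. *)
Theorem theorem3p1 (N : nat) (gT : finGroupType) :
  (2 <= N)%N ->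
  [set: gT] \isog Grp (r : s : (r ^+ N = 1, s ^+ 2 = 1, s * r * s = r^-1)) ->
  (R_k 4 gT <-> N = 2 %[mod 4]).
Proof.
move=> N2 /(dihedral_gensP N2)[r [s [gens oG]]]; split.
  exact: R_4_dihedral_mod4 gens oG.
move=> N4; have [m om Nm] : exists2 m, odd m & N = m.*2.
  by exists N./2; lia.
by apply: (@dihedral_R_4 gT m r s); rewrite -?Nm.
Qed.
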